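(* Let $\mathbb{F}$ be a definite field, let $A$ be a positive definite matrix over $\mathbb{F}$, and let $r\in\mathbb{F}$ be positive. Then $rA$ is positive definite.
   Context: An element $x$ of a field $\mathbb{F}$ is called positive if $x=\mu^2$ for some non-zero $\mu\in\mathbb{F}$; then $\mu$ is a square root of $x$, and it is a positive square root if $\mu$ is itself positive. A field is a definite field if each of its positive elements has a positive square root in it. A symmetric $n\times n$ matrix $A$ over a definite field $\mathbb{F}$ has a Cholesky decomposition if $A=LL^T$ for some lower triangular $n\times n$ matrix $L$ over $\mathbb{F}$ all of whose diagonal entries are positive; $A$ is positive definite if it is symmetric and has a Cholesky decomposition. *)

(* Defs.v *)
From mathcomp Require Import all_boot all_order all_algebra.

Set Implicit Arguments.
Unset Strict Implicit.
Unset Printing Implicit Defensive.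

Import GRing.Theory.
Local Open Scope ring_scope.

Definition square_root (F : fieldType) (x mu : F) : Prop :=
  mu != 0 /\ x = mu ^+ 2.

Definition is_positive (F : fieldType) (x : F) : Prop :=
  exists mu : F, square_root x mu.

Definition positive_square_root (F : fieldType) (x mu : F) : Prop :=
  square_root x mu /\ is_positive mu.

Definition definite_field (F : fieldType) : Prop :=
  forall x : F, is_positive x -> exists mu : F, positive_square_root x mu.

(* [is_trig_mx L] is lower triangularity: L i j = 0 whenever i < j. *)
Definition has_cholesky (F : fieldType) (n : nat) (A : 'M[F]_n) : Prop :=
  exists L : 'M[F]_n,
    [/\ is_trig_mx L, forall i : 'I_n, is_positive (L i i) & A = L *m L^T].

Definition positive_definite (F : fieldType) (n : nat) (A : 'M[F]_n) : Prop :=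
  A^T = A /\ has_cholesky A.

(* Main.v *)
Require Import Defs.
From mathcomp Require Import all_boot all_order all_algebra.
Local Open Scope ring_scope.
Import GRing.Theory.

(** If [r] has a square root [m] that is itself positive, and [A = L L^T] is a
    Cholesky decomposition, then [(m L) (m L)^T = m^2 (L L^T) = r A], and
    [m L] is again lower triangular with positive diagonal, because positive
    elements are closed under products. The definite field hypothesis is what
    supplies such an [m]: an arbitrary square root of [r] could spoil the
    positivity of the diagonal. *)

Lemma is_positiveM (F : fieldType) (x y : F) :
  is_positive x -> is_positive y -> is_positive (x * y).
Proof.
move=> [a [a0 ->]] [b [b0 ->]]; exists (a * b).
by split; [rewrite mulf_neq0 | rewrite exprMn].
Qed.

Lemma has_cholesky_scale_sqr (F : fieldType) (n : nat) (A : 'M[F]_n) (m : F) :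
  is_positive m -> has_cholesky A -> has_cholesky (m ^+ 2 *: A).
Proof.
move=> m_pos [L [L_trig L_diag ->]]; exists (m *: L); split.
- apply/is_trig_mxP => i j lt_ij.
  by rewrite mxE (is_trig_mxP L_trig) ?mulr0.
- by move=> i; rewrite mxE; apply: is_positiveM.
- by rewrite linearZ /= -scalemxAl -scalemxAr scalerA expr2.
Qed.

Theorem theorem7 (F : fieldType) (hF : definite_field F) (n : nat)
    (A : 'M[F]_n) (hA : positive_definite A) (r : F) (hr : is_positive r) :
  positive_definite (r *: A).
Proof.
have [A_sym A_chol] := hA.
have [m [[_ ->] m_pos]] := hF r hr.
split; first by rewrite linearZ /= A_sym.
exact: has_cholesky_scale_sqr.
Qed.
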